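(* Let $n$ be even. Let $k=lt$ with positive integers $l,t$, and let $f:\mathbb F_{2^n}\to\mathbb Z_{2^k}$ be a g-hyperbent function given as $$f(x)=b_1(x)+2^tb_2(x)+\cdots+2^{(l-1)t}b_l(x)$$ for some functions $b_i:\mathbb F_{2^n}\to\mathbb Z_{2^t}$, $1\le i\le l$. Then for every $\mathbf c=(c_1,c_2,\ldots,c_{l-1})\in\mathbb Z_{2^t}^{l-1}$, the function $$g_{\mathbf c}(x)=c_1b_1(x)+\cdots+c_{l-1}b_{l-1}(x)+b_l(x)$$ from $\mathbb F_{2^n}$ to $\mathbb Z_{2^t}$ is g-hyperbent.
   Context: In the expression for $f$, the values of $b_i$ are read as their integer representatives in $\{0,1,\ldots,2^t-1\}$; $g_{\mathbf c}$ is computed in the ring $\mathbb Z_{2^t}$. Let $\zeta_{2^r}=e^{2\pi i/2^r}$ and let $\mathrm{Tr}_n:\mathbb F_{2^n}\to\mathbb F_2$ be the absolute trace. A function $F:\mathbb F_{2^n}\to\mathbb Z_{2^r}$ is called g-hyperbent (generalized hyperbent) if $$\left|\sum_{x\in\mathbb F_{2^n}}\zeta_{2^r}^{F(x)}(-1)^{\mathrm{Tr}_n(ux^i)}\right|=2^{n/2}$$ for all $u\in\mathbb F_{2^n}$ and all integers $i\ge1$ with $\gcd(i,2^n-1)=1$. *)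

(* Defs.v *)
From HB Require Import structures.
From mathcomp Require Import all_boot all_order all_algebra all_field.
From mathcomp Require Import complex.
From mathcomp Require Import reals exp trigo.

Set Implicit Arguments.
Unset Strict Implicit.
Unset Printing Implicit Defensive.

Import Order.TTheory GRing.Theory Num.Theory.
Local Open Scope ring_scope.

(* Absolute trace of x when #|F| = 2 ^ n.  It is F-valued, but lies in the
   prime field {0, 1}: see [abs_trace_F2]. *)
Definition abs_trace (F : finFieldType) (n : nat) (x : F) : F :=
  \sum_(i < n) x ^+ (2 ^ i).

Lemma abs_trace_F2 (F : finFieldType) (n : nat) (x : F) :
  #|F| = (2 ^ n)%N -> (abs_trace n x == 0) || (abs_trace n x == 1).
Proof.
move=> cF; have ch2 : 2%N \in [pchar F] by exact: (card_finPcharP cF).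
suff: abs_trace n x ^+ 2 = abs_trace n x.
  move/eqP; rewrite expr2 -subr_eq0 -{3}[abs_trace n x]mulr1 -mulrBr mulf_eq0.
  by rewrite subr_eq0.
rewrite -(pFrobenius_autE ch2) /abs_trace rmorph_sum /=.
under eq_bigr => i _ do rewrite pFrobenius_autE -exprM -expnSr.
case: n cF => [|n] cF; first by rewrite !big_ord0.
by rewrite big_ord_recr big_ord_recl /= -cF expf_card expn0 expr1 addrC.
Qed.

(* (-1) ^ Tr_n(x), using that Tr_n(x) is either 0 or 1. *)
Definition trace_sign (R : realType) (F : finFieldType) (n : nat) (x : F) :
    R[i] :=
  (-1) ^+ (abs_trace n x != 0).

(* e ^ (2 pi i / m) *)
Definition zeta (R : realType) (m : nat) : R[i] :=
  Complex (cos (2 * pi / m%:R)) (sin (2 * pi / m%:R)).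

(* Meant for #|F| = 2 ^ n and 0 < r: 'Z_m is the ring of integers modulo m only
   for 1 < m.  The exponent [f x] is the representative in {0, ..., 2^r - 1};
   [`^] is the real power, so the right-hand side is 2 ^ (n / 2). *)
Definition g_hyperbent (R : realType) (F : finFieldType) (n r : nat)
    (f : F -> 'Z_(2 ^ r)) : Prop :=
  forall (u : F) (i : nat), (1 <= i)%N -> coprime i (2 ^ n - 1) ->
    `| \sum_(x : F) zeta R (2 ^ r) ^+ (f x : nat) * trace_sign R n (u * x ^+ i) |
    = (real_complex R (2 `^ (n%:R / 2))).

(* The index of b_l, when b_1, ..., b_l are indexed by 0, ..., l - 1. *)
Definition last_ord (l : nat) (l_gt0 : (0 < l)%N) : 'I_l :=
  Ordinal (etrans (ltn_predL l) l_gt0).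

(* b_1(x) + 2^t b_2(x) + ... + 2^((l-1)t) b_l(x) in Z_(2^k), where each b_i(x)
   is first read as an integer in {0, ..., 2^t - 1}. *)
Definition digit_sum (F : finFieldType) (k l t : nat)
    (b : 'I_l -> F -> 'Z_(2 ^ t)) (x : F) : 'Z_(2 ^ k) :=
  (\sum_(i < l) 2 ^ (i * t) * (b i x : nat))%:R.

Definition component (F : finFieldType) (l t : nat) (l_gt0 : (0 < l)%N)
    (b : 'I_l -> F -> 'Z_(2 ^ t)) (c : 'I_l.-1 -> 'Z_(2 ^ t)) (x : F) :
    'Z_(2 ^ t) :=
  \sum_(i < l.-1) c i * b (widen_ord (leq_pred l) i) x + b (last_ord l_gt0) x.

(* Main.v *)
(* For fixed (u, i), let z be a primitive 2^k-th root of unity, m = 2^(k-1), and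
   write the sum attached to f as A = sum_(v < m) E_v z^v, where E_v is the
   signed count of the fibre of f over v minus that over v + m.  Hyperbentness
   gives A A^* = 2^n with n even.  In Z[z] the number 2 is associated to
   (1 - z)^m, Z[z]/(1 - z) = F_2, and 1 - z is associated to its conjugate, so
   2^(n/2) divides A.  The powers of z below m are linearly independent, hence
   2^(n/2) divides every E_v, while comparing constant coefficients in
   A A^* = 2^n gives sum_v E_v^2 = 2^n: exactly one E_v is nonzero, and it is
   2^(n/2) up to sign.  Finally g_c(x) = psi(f(x)) with psi(v + m) =
   psi(v) + 2^(t-1), because adding m flips only the top bit of the last digit,
   whose coefficient is 1.  So the sum attached to g_c is
   sum_(v < m) E_v w^(psi(v)) for w a primitive 2^t-th root of unity, and has a
   single nonzero term, of modulus 2^(n/2). *)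
Require Import Defs.
From mathcomp Require Import all_boot all_order all_algebra all_field.
From mathcomp Require Import complex.
From mathcomp Require Import reals exp trigo.
From mathcomp Require Import ring.

Set Implicit Arguments.
Unset Strict Implicit.
Unset Printing Implicit Defensive.

Import Order.TTheory GRing.Theory Num.Theory.
Local Open Scope ring_scope.

(** * Irreducibility of X^(2^s) + 1 after the shift by one *)

Lemma expr_1addX_pow2 (s : nat) : exists r : {poly int},
  (1 + 'X) ^+ (2 ^ s) = 1 + 'X^(2 ^ s) + r *+ 2.
Proof.
elim: s => [|s [r IH]]; first by exists 0; rewrite mul0rn addr0.
(* This comes from squaring 1 + Y + 2 r with Y = X^(2^s). *)
exists ('X^(2 ^ s) + r * (1 + 'X^(2 ^ s)) *+ 2 + r ^+ 2 *+ 2).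
by rewrite expnSr !exprM IH; ring.
Qed.

Lemma size_exp_XaddC1 (R : nzRingType) (m : nat) :
  size (('X + 1) ^+ m : {poly R}) = m.+1.
Proof.
by rewrite -[X in 'X + X]opprK -polyC1 -polyCN size_exp_XsubC.
Qed.

Lemma size_shift_cyclotomic (R : nzRingType) (m : nat) :
  (0 < m)%N -> size (('X + 1) ^+ m + 1 : {poly R}) = m.+1.
Proof.
move=> m_gt0; by rewrite size_polyDl ?size_exp_XaddC1 ?size_poly1 ?ltnS.
Qed.

(** Eisenstein at 2: modulo 2 the polynomial is X^(2^s), and its constant term is 2. *)
Lemma irreducible_shift_cyclotomic (s : nat) :
  irreducible_poly (('X + 1) ^+ (2 ^ s) + 1 : {poly int}).
Proof.
set m := (2 ^ s)%N; have m_gt0 : (0 < m)%N by rewrite expn_gt0.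
have [r Er] := expr_1addX_pow2 s; rewrite -/m in Er.
set e := _ + 1.
have sz : size e = m.+1 by exact: size_shift_cyclotomic.
have mon : lead_coef e = 1.
  rewrite /e lead_coefDl ?size_exp_XaddC1 ?size_poly1 ?ltnS //.
  by rewrite lead_coef_exp lead_coefXaddC expr1n.
have Ee : e = 'X^m + (1 + r) *+ 2 by rewrite /e (addrC 'X) Er; ring.
apply: (@eisenstein_crit 2) => //.
- by rewrite sz eqSS -lt0n.
- by rewrite mon.
- by rewrite -horner_coef0 /e !hornerE expr1n.
move=> i; rewrite sz /= => lt_im.
rewrite Ee coefD coefXn (ltn_eqF lt_im) add0r coefMn -mulr_natr.
exact: dvdz_mull.
Qed.

(** Shifted by one, a nonzero p has smaller degree than the irreducible [e], hence is coprime to it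
    over the rationals; yet both vanish at z - 1. *)
Lemma root_pow2_cyclotomic_free (C : numFieldType) (s : nat) (z : C)
    (p : {poly int}) :
  z ^+ (2 ^ s) = -1 -> (size p <= 2 ^ s)%N -> root (map_poly intr p) z -> p = 0.
Proof.
move=> zm szp pz; set m := (2 ^ s)%N in zm szp.
pose e : {poly int} := ('X + 1) ^+ m + 1.
pose q := p \Po ('X + 1%:P).
have szq : size q = size p by rewrite size_comp_poly2 // size_XaddC.
apply/eqP; rewrite -size_poly_eq0 -szq size_poly_eq0; apply/negPn/negP => q0.
have sze : size e = m.+1 by rewrite size_shift_cyclotomic ?expn_gt0.
pose toC (f : {poly int}) := map_poly (intr : int -> C) f.
have toCE f : toC f = map_poly ratr (map_poly (intr : int -> rat) f).
  rewrite -map_poly_comp; apply: eq_map_poly => x /=; by rewrite ratr_int.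
have : coprimep (toC e) (toC q).
  rewrite !toCE coprimep_map irreducible_poly_coprime; last first.
    by apply/irreducible_rat_int; apply: irreducible_shift_cyclotomic.
  rewrite dvdp_rat_int; apply/negP => /(dvdp_leq q0).
  by rewrite sze szq ltnNge szp.
have re : root (toC e) (z - 1).
  rewrite /root /toC /e rmorphD rmorphXn rmorphD /= map_polyX rmorph1.
  by rewrite !hornerE subrK zm addNr.
move/coprimep_root => /(_ _ re); case/negP.
rewrite /toC /q map_comp_poly horner_comp rmorphD /= map_polyX map_polyC /=.
by rewrite !hornerE subrK.
Qed.

(** * The ring Z[z] and its element 1 - z *)

Definition in_Zadj (C : numFieldType) (z x : C) : Prop :=
  exists p : {poly int}, x = (map_poly intr p).[z].

Section IntegerAdjunction.
Variables (C : numFieldType).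
Implicit Types z x y : C.

Lemma in_Zadj_int z (a : int) : in_Zadj z a%:~R.
Proof. by exists a%:P; rewrite map_polyC hornerC. Qed.

Lemma in_Zadj_gen z : in_Zadj z z.
Proof. by exists 'X; rewrite map_polyX hornerX. Qed.

Lemma in_ZadjD z x y : in_Zadj z x -> in_Zadj z y -> in_Zadj z (x + y).
Proof. by move=> [p ->] [q ->]; exists (p + q); rewrite rmorphD hornerD. Qed.

Lemma in_ZadjM z x y : in_Zadj z x -> in_Zadj z y -> in_Zadj z (x * y).
Proof. by move=> [p ->] [q ->]; exists (p * q); rewrite rmorphM hornerM. Qed.

Lemma in_ZadjB z x y : in_Zadj z x -> in_Zadj z y -> in_Zadj z (x - y).
Proof. by move=> [p ->] [q ->]; exists (p - q); rewrite rmorphB !hornerE. Qed.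

Lemma in_ZadjN z x : in_Zadj z x -> in_Zadj z (- x).
Proof. by move=> [p ->]; exists (- p); rewrite rmorphN !hornerE. Qed.

Lemma in_ZadjX z x (j : nat) : in_Zadj z x -> in_Zadj z (x ^+ j).
Proof.
move=> zx; elim: j => [|j IH]; first exact: (in_Zadj_int _ 1).
by rewrite exprS; exact: in_ZadjM.
Qed.

Lemma in_Zadj_sum z (I : Type) (r : seq I) (G : I -> C) :
  (forall i, in_Zadj z (G i)) -> in_Zadj z (\sum_(i <- r) G i).
Proof.
move=> zG; elim/big_rec: _ => [|i x _]; first exact: (in_Zadj_int _ 0).
exact: in_ZadjD.
Qed.

Lemma in_Zadj_trans z x y : in_Zadj z x -> in_Zadj x y -> in_Zadj z y.
Proof.
move=> [p ->] [q ->]; exists (q \Po p).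
by rewrite map_comp_poly horner_comp.
Qed.

(** X - 1 divides p - p(1), so every class of Z[z] modulo 1 - z contains an integer. *)
Lemma in_Zadj_modX z x : in_Zadj z x ->
  exists a : int, exists2 y, in_Zadj z y & x = a%:~R + (1 - z) * y.
Proof.
move=> [p ->]; have /factor_theorem [q Eq] : root (p - p.[1]%:P) 1.
  by rewrite /root !hornerE subrr.
exists p.[1]; exists (- (map_poly intr q).[z]); first
  by apply: in_ZadjN; exists q.
rewrite -[p in LHS](subrK p.[1]%:P) Eq rmorphD rmorphM rmorphB /=.
by rewrite map_polyX !map_polyC /= !hornerE; ring.
Qed.

(** Division by X^m + 1 stays over the integers because this polynomial is monic, and it vanishes at
    z. *)
Lemma in_Zadj_small z x (m : nat) : (0 < m)%N -> z ^+ m = -1 -> in_Zadj z x ->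
  exists2 p : {poly int}, (size p <= m)%N & x = (map_poly intr p).[z].
Proof.
move=> m_gt0 zm [p ->]; pose d : {poly int} := 'X^m + 1.
have szd : size d = m.+1.
  by rewrite /d size_polyDl size_polyXn ?size_poly1 ?ltnS.
have mon : d \is monic.
  by rewrite monicE /d lead_coefDl ?lead_coefXn // size_polyXn size_poly1.
exists (Pdiv.CommonRing.rmodp p d).
  by rewrite -ltnS -szd Pdiv.Ring.ltn_rmodpN0 ?monic_neq0.
rewrite {1}(Pdiv.RingMonic.rdivp_eq mon p) rmorphD rmorphM /= rmorphD /=.
by rewrite map_polyXn rmorph1 !hornerE zm addNr mulr0 add0r.
Qed.

Lemma in_Zadj_two_div z (m : nat) : z ^+ m = -1 -> in_Zadj z (2 / (1 - z)).
Proof.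
(* If z = 1, the quotient is 0 by the convention on the inverse of 0. Otherwise it is a geometric
   sum, as 1 - z^m = 2. *)
move=> zm; have [->|z1] := eqVneq (1 - z) 0.
  by rewrite invr0 mulr0; exact: (in_Zadj_int _ 0).
have -> : 2 / (1 - z) = \sum_(i < m) z ^+ i.
  apply: (mulIf z1); rewrite divfK // mulrC -opprB mulNr -subrX1 zm; ring.
by apply: in_Zadj_sum => i; apply/in_ZadjX/in_Zadj_gen.
Qed.

(* 1 - z^2 is associated to (1 - z)^2, as (1 + z) / (1 - z) = 2 / (1 - z) - 1
   and similarly for its inverse; so the case of z follows from that of z^2. *)
Lemma two_assoc_pow2 (s : nat) z : z ^+ (2 ^ s) = -1 ->
  in_Zadj z (2 / (1 - z) ^+ (2 ^ s)) /\ in_Zadj z ((1 - z) ^+ (2 ^ s) / 2).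
Proof.
elim: s z => [|s IH] z.
  rewrite !expr1 => ->; rewrite opprK -[1 + 1]/(2%:R) divff ?pnatr_eq0 //.
  by split; exact: (in_Zadj_int _ 1).
move=> zm; have z2m : (z ^+ 2) ^+ (2 ^ s) = -1 by rewrite -exprM -expnS.
(* The exponent is even, so the geometric sum is available for - z too and puts 2 / (1 + z) in
   Z[z]. *)
have Nzm : (- z) ^+ (2 ^ s.+1) = -1.
  by rewrite exprNn zm expnS exprM sqrrN !expr1n mul1r.
have z2 : z ^+ 2 != 1.
  apply/eqP => z2; move/eqP: z2m; rewrite z2 expr1n eq_sym -subr_eq0.
  by rewrite -opprD oppr_eq0 (pnatr_eq0 C 2).
have zB : 1 - z != 0.
  by apply: contra z2; rewrite subr_eq0 => /eqP <-; rewrite expr1n.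
have zD : 1 + z != 0.
  apply: contra z2; rewrite addr_eq0 -eqr_oppLR => /eqP <-.
  by rewrite sqrrN expr1n.
have z2B : 1 - z ^+ 2 != 0 by rewrite subr_eq0 eq_sym.
have z2z x : in_Zadj (z ^+ 2) x -> in_Zadj z x.
  by apply: in_Zadj_trans; apply/in_ZadjX/in_Zadj_gen.
have two_neq0 : (2 : C) != 0 by rewrite pnatr_eq0.
have u1 : in_Zadj z ((1 - z) / (1 + z)).
  have -> : (1 - z) / (1 + z) = 2 / (1 - - z) - 1 by rewrite opprK; field.
  apply: in_ZadjB (in_Zadj_int _ 1); apply: in_Zadj_trans (in_Zadj_two_div Nzm).
  exact/in_ZadjN/in_Zadj_gen.
have u2 : in_Zadj z ((1 + z) / (1 - z)).
  have -> : (1 + z) / (1 - z) = 2 / (1 - z) - 1 by field.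
  exact: in_ZadjB (in_Zadj_two_div zm) (in_Zadj_int _ 1).
have [A1 A2] := IH _ z2m.
have E : (1 - z) ^+ (2 ^ s.+1) =
    (1 - z ^+ 2) ^+ (2 ^ s) * ((1 - z) / (1 + z)) ^+ (2 ^ s).
  by rewrite expnS exprM -exprMn; congr (_ ^+ _); field.
split.
  have -> : 2 / (1 - z) ^+ (2 ^ s.+1) =
      2 / (1 - z ^+ 2) ^+ (2 ^ s) * ((1 + z) / (1 - z)) ^+ (2 ^ s).
    by rewrite E invfM mulrA -[((_ / _) ^+ _)^-1]exprVn invf_div.
  by apply: in_ZadjM (z2z _ A1) (in_ZadjX _ u2).
have -> : (1 - z) ^+ (2 ^ s.+1) / 2 =
    (1 - z ^+ 2) ^+ (2 ^ s) / 2 * ((1 - z) / (1 + z)) ^+ (2 ^ s).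
  by rewrite E mulrAC.
by apply: in_ZadjM (z2z _ A2) (in_ZadjX _ u1).
Qed.

Lemma one_sub_root_of_minus_one_neq0 z (m : nat) : z ^+ m = -1 -> 1 - z != 0.
Proof.
move=> zm; apply/eqP => /eqP; rewrite subr_eq0 => /eqP z1; move/eqP: zm.
by rewrite -z1 expr1n eq_sym -subr_eq0 -opprD oppr_eq0 (pnatr_eq0 C 2).
Qed.

(** Otherwise 2, an associate of a power of 1 - z, would also be a unit. Writing 1/2 = p(z) with p
    of degree below 2^s, linear independence gives 2 p = 1, which parity forbids. *)
Lemma one_sub_root_not_unit (s : nat) z :
  z ^+ (2 ^ s) = -1 -> ~ in_Zadj z (1 - z)^-1.
Proof.
move=> zm iz; have m_gt0 : (0 < 2 ^ s)%N by rewrite expn_gt0.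
have z1 := one_sub_root_of_minus_one_neq0 zm.
have : in_Zadj z 2^-1.
  have -> : 2^-1 = (1 - z)^-1 ^+ (2 ^ s) * ((1 - z) ^+ (2 ^ s) / 2).
    by rewrite mulrA -exprMn mulVf // expr1n mul1r.
  by apply: in_ZadjM (two_assoc_pow2 zm).2; apply: in_ZadjX.
case/(in_Zadj_small m_gt0 zm) => p szp Ep.
have : p *+ 2 - 1 = 0.
  apply: (root_pow2_cyclotomic_free zm).
    apply: leq_trans (size_polyD _ _) _.
    rewrite geq_max size_polyN size_poly1 m_gt0.
    by rewrite andbT -scaler_nat (leq_trans (size_scale_leq _ _)).
  rewrite /root rmorphB rmorphMn rmorph1 /=.
  rewrite hornerD hornerMn hornerN hornerC -Ep.
  by rewrite -mulr_natr mulVf ?subrr // pnatr_eq0.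
move/(congr1 (coefp 0)); rewrite /= coefB coefMn coef1 coef0 => /eqP.
rewrite subr_eq0 => /eqP p0.
have : (2 %| p`_0 * 2)%Z by exact: dvdz_mull.
by rewrite mulr_natr p0.
Qed.

End IntegerAdjunction.

(** * Conjugation in Z[z] and divisibility by powers of 2 *)

Section RootOfMinusOne.
Variables (C : numClosedFieldType) (s : nat) (z : C).
Hypothesis zm : z ^+ (2 ^ s) = -1.

Let m_gt0 : (0 < 2 ^ s)%N. Proof. by rewrite expn_gt0. Qed.

Lemma norm_root_of_minus_one : `|z| = 1.
Proof.
apply/eqP; rewrite -(@pexpr_eq1 _ _ (2 ^ s)) ?normr_ge0 ?expn_gt0 //.
by rewrite -normrX zm normrN1.
Qed.

Lemma root_of_minus_one_neq0 : z != 0.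
Proof. by rewrite -normr_eq0 norm_root_of_minus_one oner_eq0. Qed.

Lemma conj_root_of_minus_one : z^* = z^-1.
Proof.
apply: (mulfI root_of_minus_one_neq0); rewrite divff ?root_of_minus_one_neq0 //.
by rewrite -normCK norm_root_of_minus_one expr1n.
Qed.

Lemma in_Zadj_conj (x : C) : in_Zadj z x -> in_Zadj z x^*.
Proof.
move=> [p ->]; apply: (@in_Zadj_trans _ _ (z^*)).
  rewrite conj_root_of_minus_one.
  have -> : z^-1 = - z ^+ (2 ^ s).-1.
    apply: (mulfI root_of_minus_one_neq0).
    by rewrite divff ?root_of_minus_one_neq0 // mulrN -exprS prednK // zm opprK.
  exact/in_ZadjN/in_ZadjX/in_Zadj_gen.
exists p; rewrite -horner_map /= -map_poly_comp; congr _.[_].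
by apply: eq_map_poly => a /=; rewrite rmorph_int.
Qed.

(* If x / (1 - z)^j = a + (1 - z) w with j < h 2^s, then a^2 is congruent to
   x x^* / |1 - z|^(2j), a multiple of 1 - z; so a is even and 1 - z divides
   x / (1 - z)^j once more. *)
Lemma in_Zadj_div_pow2 (h : nat) (x : C) :
  in_Zadj z x -> `|x| = 2 ^+ h -> in_Zadj z (x / 2 ^+ h).
Proof.
move=> zx nx; set q := 1 - z; set m := (2 ^ s)%N.
have q0 : q != 0 by exact: one_sub_root_of_minus_one_neq0 zm.
have z0 := root_of_minus_one_neq0.
have [A1 A2] := two_assoc_pow2 zm; rewrite -/q -/m in A1 A2.
have zz := in_Zadj_gen z.
have zq : in_Zadj z q by exact: in_ZadjB (in_Zadj_int _ 1) zz.
have qC : q^* = q / - z.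
  by rewrite /q rmorphB rmorph1 /= conj_root_of_minus_one; field.
have two_neq0 : (2 : C) != 0 by rewrite pnatr_eq0.
have xx : x * x^* = 2 ^+ h * 2 ^+ h by rewrite -normCK nx expr2.
(* As 2 and q^m are associated, dividing by 2^h amounts to dividing by q^(m h), one factor q at a
   time. *)
suff H j : (j <= m * h)%N -> in_Zadj z (x / q ^+ j).
  have -> : x / 2 ^+ h = x / q ^+ (m * h) * (q ^+ m / 2) ^+ h.
    by rewrite expr_div_n -exprM mulrA divfK // expf_neq0.
  by apply: in_ZadjM (H _ (leqnn _)) (in_ZadjX _ A2).
elim: j => [|j IH] lt_j; first by rewrite expr0 divr1.
have {IH} zy := IH (ltnW lt_j); set y := x / q ^+ j in zy.
have [a [w zw Ey]] := in_Zadj_modX zy; rewrite -/q in Ey.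
(* Each factor 2^h of x x^* is (2 / q^m)^h q^(m h). As j < m h, a factor q survives the division by
   q^j and its conjugate. *)
have yy : y * y^* = q * ((2 / q ^+ m) ^+ h * ((2 / q ^+ m) ^+ h *
    q ^+ (m * h + m * h - (j + j).+1) * (- z) ^+ j)).
  rewrite /y rmorphM fmorphV rmorphXn /= qC mulrACA xx.
  have -> : q ^+ (m * h + m * h - (j + j).+1) =
      q ^+ (m * h) * q ^+ (m * h) / (q * q ^+ j * q ^+ j).
    rewrite -exprD -exprS -exprD addSn expfB //.
    by rewrite -addSn -addnS leq_add // ltnW.
  rewrite !expr_div_n -!exprM.
  have Nz0 : - z != 0 by rewrite oppr_eq0.
  move: (expf_neq0 (m * h) q0) (expf_neq0 j q0) (expf_neq0 j Nz0).
  move: (2 ^+ h) (q ^+ (m * h)) (q ^+ j) ((- z) ^+ j) => r P Q N P0 Q0 N0.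
  by field; rewrite P0 Q0 N0 q0.
have a_even : (2 %| a)%Z.
  apply/negPn/negP => a_odd; apply: (one_sub_root_not_unit zm); rewrite -/q.
  have [c Ea] : exists c : int, a ^+ 2 = 1 + c * 2.
    have Er : (a %% 2)%Z = 1.
      have : (a %% 2)%Z != 0 by apply: contra a_odd => /eqP/dvdz_mod0P.
      have := @ltz_pmod a 2 isT.
      by have := @modz_ge0 a 2 isT; case: (_ %% _)%Z => [[|[|]]|].
    exists ((a %/ 2)%Z ^+ 2 * 2 + (a %/ 2)%Z * 2).
    by rewrite {1}(divz_eq a 2) Er; ring.
  set v := (X in _ = q * X) in yy.
  have zv : in_Zadj z v.
    do !apply: in_ZadjM; try exact: in_ZadjX.
    exact/in_ZadjX/in_ZadjN.
  have zC := in_Zadj_conj zw.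
  (* Expanding y y^* = q v with y = a + q w gives a^2 = q v - q w y^* + q a w^* / z; put a^2 = 1 + 2
     c and divide by q. *)
  have -> : q^-1 = v - c%:~R * (2 / q) - w * y^* + a%:~R * w^* / z.
    have Ea' : (a%:~R : C) ^+ 2 = 1 + c%:~R * 2.
      by rewrite -rmorphXn /= Ea rmorphD rmorphM.
    have EyC : y^* = a%:~R - q / z * w^*.
      by rewrite Ey rmorphD rmorphM rmorph_int /= qC invrN mulrN mulNr.
    apply: (mulfI q0); 
    have -> : q * q^-1 = a%:~R ^+ 2 - c%:~R * 2 by rewrite Ea' addrK divff.
    have -> : q * (v - c%:~R * (2 / q) - w * y^* + a%:~R * w^* / z) =
        q * v - c%:~R * 2 - q * w * y^* + q * a%:~R * w^* / z.
      by field; rewrite ?q0 ?z0.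
    by rewrite -yy EyC Ey; field; rewrite ?q0 ?z0.
  apply: in_ZadjD; last first.
    apply: in_ZadjM; first exact: in_ZadjM (in_Zadj_int _ _) zC.
    by rewrite -conj_root_of_minus_one; exact: in_Zadj_conj.
  apply: in_ZadjB (in_ZadjM zw (in_Zadj_conj zy)).
  apply: in_ZadjB zv (in_ZadjM (in_Zadj_int _ _) _).
  exact: in_Zadj_two_div zm.
have /dvdzP [c Ea] := a_even.
have -> : x / q ^+ j.+1 = c%:~R * (2 / q) + w.
  rewrite exprSr invfM mulrA -/y Ey Ea rmorphM /=; field.
  by rewrite q0.
apply: in_ZadjD zw; apply: in_ZadjM (in_Zadj_int _ _) _.
exact: in_Zadj_two_div zm.
Qed.

(** * Sums with negaperiodic coefficients *)

Lemma negaperiodic_rotation (E : nat -> C) (w : nat) :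
  (forall d, E (d + 2 ^ s)%N = - E d) ->
  z ^+ w * (\sum_(d < 2 ^ s) E (w + d)%N * z ^+ d) =
    \sum_(d < 2 ^ s) E d * z ^+ d.
Proof.
move=> EN; elim: w => [|w IH]; first by rewrite mul1r.
rewrite -[RHS]IH exprSr -mulrA mulr_sumr; congr (_ * _).
pose G d := E (w + d)%N * z ^+ d.
transitivity (\sum_(d < 2 ^ s) G d.+1).
  by apply: eq_bigr => d _; rewrite /G addSnnS exprS mulrCA.
(* The window loses [G 0] and gains [G (2 ^ s)]. These agree, because the signs from E and from
   z^(2^s) cancel. *)
apply: (addrI (G 0%N)); rewrite -(big_ord_recl _ (fun d : 'I__ => G d)).
by rewrite big_ord_recr /= addrC {1}/G EN zm mulrN1 opprK /G addn0 mulr1.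
Qed.

Lemma map_poly_horner_sum (m : nat) (E : nat -> int) :
  (map_poly intr (\poly_(d < m) E d)).[z] = \sum_(d < m) (E d)%:~R * z ^+ d.
Proof.
rewrite poly_def rmorph_sum horner_sum; apply: eq_bigr => d _ /=.
by rewrite map_polyZ map_polyXn !hornerE.
Qed.

(** By rotation, the squared norm is the sum of the [G d] z^d, with [G] the negacyclic
    autocorrelation of E. Linear independence forces [G 0] = a. *)
Lemma negaperiodic_correlation (E : nat -> int) (a : int) :
  (forall d, E (d + 2 ^ s)%N = - E d) ->
  `|\sum_(d < 2 ^ s) (E d)%:~R * z ^+ d| ^+ 2 = a%:~R ->
  \sum_(d < 2 ^ s) E d ^+ 2 = a.
Proof.
move=> EN nA; pose G d := \sum_(w < 2 ^ s) E w * E (w + d)%N.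
have : \poly_(d < 2 ^ s) G d - a%:P = 0.
  apply: (root_pow2_cyclotomic_free zm).
    apply: leq_trans (size_polyD _ _) _; rewrite geq_max size_poly size_polyN.
    exact: leq_trans (size_polyC_leq1 _) m_gt0.
  rewrite /root rmorphB /= map_polyC /= hornerD hornerN hornerC subr_eq0.
  rewrite map_poly_horner_sum -nA normCK; apply/eqP.
  set A := \sum_(d < _) _ in nA *.
  transitivity (\sum_(w < 2 ^ s) ((E w)%:~R * z ^+ w)^* * A); last first.
    by rewrite -mulr_suml -rmorph_sum mulrC.
  under eq_bigr => d _ do rewrite rmorph_sum mulr_suml.
  rewrite exchange_big; apply: eq_bigr => w _ /=.
  rewrite rmorphM rmorphXn /= rmorph_int conj_root_of_minus_one /A.
  have EN' d : (E (d + 2 ^ s)%N)%:~R = - (E d)%:~R :> C by rewrite EN rmorphN.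
  rewrite -(negaperiodic_rotation w EN').
  rewrite -mulrA [X in _ = _ * X]mulrA -exprMn mulVf ?root_of_minus_one_neq0 //.
  rewrite expr1n mul1r mulr_sumr; apply: eq_bigr => d _.
  by rewrite rmorphM /= mulrA.
move/(congr1 (coefp 0)); rewrite /= coefB coef_poly coefC coef0 m_gt0 => /eqP.
rewrite subr_eq0 => /eqP <-; apply: eq_bigr => w _.
by rewrite addn0 expr2.
Qed.

Lemma sum_sqr_eq1 (I : finType) (a : I -> int) :
  \sum_i a i ^+ 2 = 1 -> exists2 v, `|a v| = 1 & forall w, w != v -> a w = 0.
Proof.
move=> sum1; have [v av] : exists v, a v != 0.
  apply/existsP; apply: contraPT sum1 => /existsPn a0.
  by rewrite big1 // => i _; move: (a0 i); rewrite negbK => /eqP->;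
    rewrite expr0n.
exists v; last first => [w wv|]; move: sum1; rewrite (bigD1 v) //=.
  have av1 : 1 <= a v ^+ 2 by rewrite -gtz0_ge1 exprn_even_gt0.
  move=> sum1; have : \sum_(i | i != v) a i ^+ 2 <= 0.
    by rewrite -(lerD2l (a v ^+ 2)) addr0 sum1.
  rewrite le_eqVlt ltNge sumr_ge0 ?orbF => [|i _]; last exact: sqr_ge0.
  rewrite psumr_eq0 => [/allP/(_ w)|i _]; last exact: sqr_ge0.
  by rewrite mem_index_enum wv sqrf_eq0 => /(_ isT)/eqP.
have av1 : 1 <= `|a v| by rewrite -gtz0_ge1 normr_gt0.
move=> sum1; apply/eqP; rewrite eq_le av1 andbT -(@ler_pXn2r _ 2) ?nnegrE //.
rewrite expr1n real_normK ?num_real // -sum1 lerDl.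
by apply: sumr_ge0 => i _; exact: sqr_ge0.
Qed.

(** Linear independence passes divisibility by 2^h from the sum to each coefficient; the quotients
    then have squares adding up to 1. *)
Lemma cyclotomic_norm_pow2 (h : nat) (E : nat -> int) :
  (forall d, E (d + 2 ^ s)%N = - E d) ->
  `|\sum_(d < 2 ^ s) (E d)%:~R * z ^+ d| = 2 ^+ h ->
  exists2 v : 'I_(2 ^ s), `|E v| = 2 ^+ h &
    forall w : 'I_(2 ^ s), w != v -> E w = 0.
Proof.
move=> EN nA; have two_neq0 : (2 : C) != 0 by rewrite pnatr_eq0.
have [p szp Ep] : exists2 p : {poly int}, (size p <= 2 ^ s)%N &
    (\sum_(d < 2 ^ s) (E d)%:~R * z ^+ d) / 2 ^+ h = (map_poly intr p).[z].
  apply: in_Zadj_small => //; apply: in_Zadj_div_pow2 nA.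
  by rewrite -map_poly_horner_sum; eexists.
have pE : \poly_(d < 2 ^ s) E d - 2 ^+ h *: p = 0.
  apply: (root_pow2_cyclotomic_free zm).
    apply: leq_trans (size_polyD _ _) _; rewrite geq_max size_poly size_polyN.
    exact: leq_trans (size_scale_leq _ _) szp.
  rewrite /root rmorphB /= map_polyZ /= hornerD hornerN hornerZ -Ep.
  rewrite map_poly_horner_sum rmorphXn /= mulrC divfK ?subrr //.
  by rewrite expf_neq0.
have {}pE (d : 'I_(2 ^ s)) : E d = 2 ^+ h * p`_d.
  move/(congr1 (coefp d)): pE; rewrite /= coefB coefZ coef0 coef_poly ltn_ord.
  by move/eqP; rewrite subr_eq0 => /eqP.
have : \sum_(d < 2 ^ s) p`_d ^+ 2 = 1.
  have : \sum_(d < 2 ^ s) E d ^+ 2 = (2 ^+ h) ^+ 2.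
    by apply: negaperiodic_correlation => //; rewrite nA !rmorphXn.
  under eq_bigr do rewrite pE exprMn.
  by rewrite -mulr_sumr -[X in _ = X]mulr1; apply: mulfI; rewrite !expf_neq0.
move/sum_sqr_eq1 => [v pv p0]; exists v.
  by rewrite pE normrM pv mulr1 ger0_norm // exprn_ge0.
by move=> w wv; rewrite pE p0 // mulr0.
Qed.

End RootOfMinusOne.

(** * Folding a sum along an antiperiodic function *)

Lemma antiperiodic_reduce (R : pzRingType) (m : nat) (W : nat -> R) (a : nat) :
  (forall v, W (v + m)%N = - W v) -> W a = (-1) ^+ (a %/ m) * W (a %% m)%N.
Proof.
move=> WN; rewrite {1}(divn_eq a m); elim: (a %/ m)%N => [|q IH].
  by rewrite mul0n add0n mul1r.
by rewrite mulSn addnC addnCA addnC WN addnC IH exprS mulN1r mulNr.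
Qed.

(** For v < m and [phi] below 2 m this is the signed count over v minus that over v + m. The parity
    of the quotients extends it negaperiodically to all v. *)
Definition folded_weight (I : finType) (m : nat) (phi : I -> nat)
    (sg : I -> int) (v : nat) : int :=
  \sum_x sg x * ((phi x == v %[mod m])%:R * (-1) ^+ (phi x %/ m + v %/ m)).

Lemma folded_weightN (I : finType) (m : nat) (phi : I -> nat) (sg : I -> int)
    (v : nat) : (0 < m)%N ->
  folded_weight m phi sg (v + m) = - folded_weight m phi sg v.
Proof.
move=> m_gt0; rewrite /folded_weight -sumrN; apply: eq_bigr => x _.
by rewrite modnDr divnDr // divnn m_gt0 addn1 addnS exprS mulN1r !mulrN.
Qed.

(** Group the x by the residue of [phi x]; the sign relating W there to [W (phi x)] sits in the
    weight. The weights do not involve W, so different W can be compared. *)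
Lemma sum_folded_weight (R : comPzRingType) (I : finType) (m : nat)
    (phi : I -> nat) (sg : I -> int) (W : nat -> R) : (0 < m)%N ->
    (forall v, W (v + m)%N = - W v) ->
  \sum_x W (phi x) * (sg x)%:~R =
    \sum_(v < m) (folded_weight m phi sg v)%:~R * W v.
Proof.
move=> m_gt0 WN; under [RHS]eq_bigr do rewrite rmorph_sum mulr_suml.
rewrite exchange_big; apply: eq_bigr => x _ /=.
rewrite (bigD1 (Ordinal (ltn_pmod (phi x) m_gt0))) //= big1 ?addr0 => [|v vx].
  rewrite modn_mod eqxx mul1r (divn_small (ltn_pmod _ m_gt0)) addn0.
  by rewrite (antiperiodic_reduce (phi x) WN) rmorphM rmorph_sign mulrC mulrA.
rewrite (modn_small (ltn_ord v)) eq_sym.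
by move: vx; rewrite -val_eqE /= => /negPf ->; rewrite mul0r mulr0 mul0r.
Qed.

(** The powers of z reveal that a single weight is nonzero; replacing them by W changes only its
    factor of norm 1. *)
Lemma folded_sum_norm (C : numClosedFieldType) (I : finType) (s h : nat) (z : C)
    (phi : I -> nat) (sg : I -> int) (W : nat -> C) :
    z ^+ (2 ^ s) = -1 ->
    `|\sum_x z ^+ phi x * (sg x)%:~R| = 2 ^+ h ->
    (forall v, W (v + 2 ^ s)%N = - W v) -> (forall v, `|W v| = 1) ->
  `|\sum_x W (phi x) * (sg x)%:~R| = 2 ^+ h.
Proof.
move=> zm; have m_gt0 : (0 < 2 ^ s)%N by rewrite expn_gt0.
rewrite (sum_folded_weight _ _ m_gt0 (W := fun v => z ^+ v)) => [nz WN W1|v];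
  last first.
  by rewrite exprD zm mulrN1.
rewrite (sum_folded_weight _ _ m_gt0 WN).
have [v Ev E0] := cyclotomic_norm_pow2 zm
  (fun d => folded_weightN phi sg d m_gt0) nz.
rewrite (bigD1 v) //= big1 ?addr0 => [|w wv]; last by rewrite E0 ?mul0r.
by rewrite normrM W1 mulr1 -intr_norm Ev rmorphXn.
Qed.

(** * Powers of [zeta], digits in base B and arithmetic in ['Z_p] *)

Lemma zeta_expr (R : realType) (m j : nat) :
  zeta R m ^+ j = Complex (cos (2 * pi / m%:R *+ j)) (sin (2 * pi / m%:R *+ j)).
Proof.
elim: j => [|j IH]; first by rewrite !mulr0n cos0 sin0.
rewrite exprSr IH /zeta; set a := 2 * pi / m%:R; rewrite (mulrSr a) cosD sinD.
by apply/eqP; rewrite eq_complex /= addrC [X in _ && (X == _)]addrC !eqxx.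
Qed.

Lemma zeta_half (R : realType) (m : nat) :
  (0 < m)%N -> zeta R (2 * m) ^+ m = -1.
Proof.
move=> m_gt0; have m0 : m%:R != 0 :> R by rewrite pnatr_eq0 -lt0n.
rewrite zeta_expr; have -> : 2 * pi / (2 * m)%:R *+ m = pi :> R.
  by rewrite natrM -mulr_natr; field.
by rewrite cospi sinpi; apply/eqP; rewrite eq_complex /= oppr0 !eqxx.
Qed.

Lemma sum_digits_lt (B l : nat) (d : 'I_l -> nat) :
  (forall i, d i < B)%N -> (\sum_(i < l) B ^ i * d i < B ^ l)%N.
Proof.
elim: l d => [|l IH] d dB; first by rewrite big_ord0.
have B_gt0 : (0 < B)%N by apply: leq_ltn_trans (dB ord0).
rewrite big_ord_recr /= expnSr addnC -ltn_subRL.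
have {IH} := IH (fun i => d (widen_ord (leqnSn l) i)) (fun i => dB _).
move/leq_trans; apply; rewrite -mulnBr leq_pmulr // subn_gt0; exact: dB.
Qed.

Lemma sum_digits_mod (B l : nat) (d : 'I_l -> nat) (i : 'I_l) :
  (forall i, d i < B)%N ->
  ((\sum_(j < l) B ^ j * d j) %/ B ^ i = d i %[mod B])%N.
Proof.
elim: l d i => [|l IH] d i dB; first by case: i.
have B_gt0 : (0 < B)%N by apply: leq_ltn_trans (dB ord0).
rewrite big_ord_recl mul1n.
have -> : (\sum_(j < l) B ^ lift ord0 j * d (lift ord0 j) =
    (\sum_(j < l) B ^ j * d (lift ord0 j)) * B)%N.
  rewrite big_distrl; apply: eq_bigr => j _ /=.
  by rewrite /bump add1n expnS; ring.
rewrite addnC; case: (unliftP ord0 i) => [j|] ->; last by rewrite divn1 modnMDl.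
(* Dividing by B first discards the lowest digit. *)
rewrite /= /bump add1n expnS divnMA divnMDl // (divn_small (dB _)) addn0.
exact: IH.
Qed.

Lemma eq_natr_Zp (p a b : nat) : (1 < p)%N ->
  (a = b %[mod p])%N -> a%:R = b%:R :> 'Z_p.
Proof. by move=> p_gt1 ab; apply/val_inj; rewrite /= !val_Zp_nat. Qed.

Lemma expr_ZpD (R : pzRingType) (p : nat) (z : R) (a b : 'Z_p) :
  (1 < p)%N -> z ^+ p = 1 -> z ^+ (a + b)%R = z ^+ a * z ^+ b.
Proof.
move=> p_gt1 zp; rewrite -[a in LHS]natr_Zp -[b in LHS]natr_Zp -natrD.
by rewrite val_Zp_nat // expr_mod // exprD.
Qed.

(** * Transfer from f to its components *)

Theorem theorem4p9 (R : realType) (F : finFieldType) (n k l t : nat)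
    (cardF : #|F| = (2 ^ n)%N) (n_even : ~~ odd n)
    (l_gt0 : (0 < l)%N) (t_gt0 : (0 < t)%N) (k_eq : k = (l * t)%N)
    (b : 'I_l -> F -> 'Z_(2 ^ t)) (f : F -> 'Z_(2 ^ k))
    (f_eq : forall x : F, f x = digit_sum k b x)
    (f_hyperbent : g_hyperbent R n f) (c : 'I_l.-1 -> 'Z_(2 ^ t)) :
  g_hyperbent R n (component l_gt0 b c).
Proof.
move=> u i i_gt0 i_cop; have := f_hyperbent u i i_gt0 i_cop.
(* Evenness of n turns the real power into an integral power of 2, as divisibility in Z[z]
   requires. *)
have -> : real_complex R (2 `^ (n%:R / 2)) = 2 ^+ n./2.
  have -> : n%:R / 2 = n./2%:R :> R.
    rewrite -{1}(even_halfK n_even) -mul2n natrM mulrAC.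
    by rewrite divff ?mul1r ?pnatr_eq0.
  by rewrite powR_mulrn ?ler0n // rmorphXn /= rmorph_nat.
have k_gt0 : (0 < k)%N by rewrite k_eq muln_gt0 l_gt0.
have pow2_gt1 r : (0 < r)%N -> (1 < 2 ^ r)%N.
  by move=> r_gt0; rewrite -{1}(expn0 2) ltn_exp2l.
have b_lt j x : (b j x < 2 ^ t)%N.
  by rewrite -[X in (_ < X)%N](Zp_cast (pow2_gt1 _ t_gt0)) ltn_ord.
have b_digit j x : b j x = ((f x : nat) %/ 2 ^ (j * t))%:R.
  (* The digit sum is below (2^t)^l = 2^k, so reduction modulo 2^k leaves it unchanged. *)
  have -> : (f x : nat) = (\sum_(j < l) (2 ^ t) ^ j * (b j x : nat))%N.
    rewrite f_eq /digit_sum val_Zp_nat ?pow2_gt1 // modn_small.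
      by apply: eq_bigr => j' _; rewrite -expnM (mulnC t).
    under eq_bigr do rewrite (mulnC _ t) expnM.
    rewrite k_eq (mulnC l) expnM; exact: sum_digits_lt.
  rewrite -[LHS]natr_Zp; apply: eq_natr_Zp; first exact: pow2_gt1.
  by rewrite (mulnC j) expnM (sum_digits_mod (d := fun j => b j x)).
(* The quotients are not cut down to one digit: the cast to ['Z_(2 ^ t)] discards the higher
   ones. *)
pose psi (v : nat) : 'Z_(2 ^ t) :=
  \sum_(j < l.-1) c j * (v %/ 2 ^ (j * t))%:R + (v %/ 2 ^ (l.-1 * t))%:R.
have psiN v : psi (v + 2 ^ k.-1)%N = psi v + (2 ^ t.-1)%:R.
  have k1 : k.-1 = (l.-1 * t + t.-1)%N.
    by rewrite k_eq -{1}(prednK l_gt0) mulSn addnC -{2}(prednK t_gt0) addnS.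
  have shift j : (j <= l.-1)%N -> ((v + 2 ^ k.-1) %/ 2 ^ (j * t) =
      v %/ 2 ^ (j * t) + 2 ^ ((l.-1 - j) * t + t.-1))%N.
    move=> jl; have -> : k.-1 = ((l.-1 - j) * t + t.-1 + j * t)%N.
      by rewrite k1 addnAC -mulnDl subnK.
    by rewrite expnD divnDMl ?expn_gt0.
  rewrite /psi shift // subnn mul0n add0n natrD addrA; congr (_ + _ + _).
  apply: eq_bigr => j _; rewrite shift; last exact: ltnW.
  congr (_ * _); apply: eq_natr_Zp; first exact: pow2_gt1.
  (* For j < l - 1 the added power of 2 has exponent at least t, so it vanishes modulo 2^t. *)
  rewrite -(prednK (_ : 0 < l.-1 - j)%N) ?subn_gt0 // mulSn -addnA expnD.
  by rewrite addnC (mulnC (2 ^ t)%N) modnMDl.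
have comp_psi x : component l_gt0 b c x = psi (f x).
  rewrite /component /psi b_digit; congr (_ + _).
  by apply: eq_bigr => j _; rewrite b_digit.
have half r : (0 < r)%N -> zeta R (2 ^ r) ^+ (2 ^ r.-1) = -1.
  by move=> r_gt0; rewrite -{1}(prednK r_gt0) expnS zeta_half ?expn_gt0.
have zetaX : zeta R (2 ^ t) ^+ (2 ^ t) = 1.
  by rewrite -{2}(prednK t_gt0) expnSr exprM half // sqrrN expr1n.
(* The trace signs are recast as integers, so that the folded weights are integers. *)
rewrite (eq_bigr (fun x => zeta R (2 ^ k) ^+ (f x : nat) *
  ((-1) ^+ (abs_trace n (u * x ^+ i) != 0) : int)%:~R)) => [nf|x _]; last first.
  by rewrite rmorph_sign.
rewrite (eq_bigr (fun x => zeta R (2 ^ t) ^+ (psi (f x) : nat) *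
  ((-1) ^+ (abs_trace n (u * x ^+ i) != 0) : int)%:~R)) => [|x _]; last first.
  by rewrite comp_psi rmorph_sign.
apply: (folded_sum_norm (W := fun v => zeta R (2 ^ t) ^+ (psi v : nat))
  (half k k_gt0) nf).
  move=> v; rewrite psiN expr_ZpD ?pow2_gt1 // val_Zp_nat ?pow2_gt1 //.
  by rewrite expr_mod // half // mulrN1.
by move=> v; rewrite normrX (norm_root_of_minus_one (half t t_gt0)) expr1n.
Qed.
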